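(* Let $M\ge 0$ and $M_0\ge 0$ be real constants, let $B_M=\{\mathbf v\in\mathbb R^n : \|\mathbf v\|_2\le M\}$ and $R_0=\{R\in\mathbb R^{n\times n} : \|R\|_F\le M_0\}$, and let $\bar\Omega=\{(\mathbf c,Q,Z) : \mathbf c\in B_M,\ Q\in\mathcal O(n),\ Z\in\mathcal O(n)\}$. Suppose that $A_i,B_i,\Lambda\in R_0$ for $i=0,1,\dots,n$ and that $A(\mathbf c),B(\mathbf c)\in R_0$ for every $\mathbf c\in B_M$. Then the objective function $$F(\mathbf c,Q,Z)=\tfrac12\|\Lambda\odot(Q^\top B(\mathbf c)Z)-I_n\odot(Q^\top A(\mathbf c)Z)\|_F^2+\tfrac12\|P\odot(Q^\top A(\mathbf c)Z)\|_F^2+\tfrac12\|P\odot(Q^\top B(\mathbf c)Z)\|_F^2$$ is gradient Lipschitz continuous on $\bar\Omega$; that is, there exists a constant $L>0$ such that for all $(\mathbf c,Q,Z),(\hat{\mathbf c},\hat Q,\hat Z)\in\bar\Omega$, $$\|\nabla F(\mathbf c,Q,Z)-\nabla F(\hat{\mathbf c},\hat Q,\hat Z)\|_F\le L\big(\|Q-\hat Q\|_F+\|Z-\hat Z\|_F+\|\mathbf c-\hat{\mathbf c}\|_2\big).$$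
   Context: Let $A_0,\dots,A_n,B_0,\dots,B_n\in\mathbb R^{n\times n}$ be given real matrices and $\lambda_1\le\dots\le\lambda_n$ given real numbers. For $\mathbf c=(c_1,\dots,c_n)^\top\in\mathbb R^n$ put $A(\mathbf c)=A_0+\sum_{i=1}^n c_iA_i$ and $B(\mathbf c)=B_0+\sum_{i=1}^n c_iB_i$. $\Lambda=\operatorname{diag}\{\lambda_1,\dots,\lambda_n\}$, $I_n$ is the $n\times n$ identity matrix, and $P\in\mathbb R^{n\times n}$ is the strictly lower triangular mask matrix with $P_{ij}=1$ if $i>j$ and $P_{ij}=0$ otherwise. $\odot$ is the Hadamard (entrywise) product, $\|\cdot\|_F$ the Frobenius norm, $\|\cdot\|_2$ the Euclidean norm, and $\mathcal O(n)$ the set of real orthogonal $n\times n$ matrices. $\nabla F=(\nabla_{\mathbf c}F,\nabla_QF,\nabla_ZF)$ is the ordinary Euclidean gradient of $F$ regarded as a function on $\mathbb R^n\times\mathbb R^{n\times n}\times\mathbb R^{n\times n}$, i.e. the collection of partial derivatives with respect to the entries of $\mathbf c$, $Q$, $Z$, and the norm $\|\cdot\|_F$ of such a triple is the square root of the sum of squares of all its entries. *)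

(* Defs.v *)
From HB Require Import structures.
From mathcomp Require Import all_boot all_order all_algebra.
From mathcomp Require Import all_classical all_reals all_analysis.

Set Implicit Arguments.
Unset Strict Implicit.
Unset Printing Implicit Defensive.

Import Order.TTheory GRing.Theory Num.Theory.
Import numFieldNormedType.Exports.

Local Open Scope classical_set_scope.
Local Open Scope ring_scope.

(* The library's norm `|X| on matrices and on products is the sup norm; it only
   provides the topology in which derivatives are taken. The Euclidean and
   Frobenius norms are therefore defined separately. *)

Definition norm2 (R : realType) (n : nat) (v : 'cV[R]_n) : R :=
  Num.sqrt (\sum_(i < n) v i 0 ^+ 2).

Definition normF (R : realType) (m n : nat) (X : 'M[R]_(m, n)) : R :=
  Num.sqrt (\sum_(i < m) \sum_(j < n) X i j ^+ 2).

Definition hadamard (R : realType) (m n : nat) (X Y : 'M[R]_(m, n)) :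
  'M[R]_(m, n) := map2_mx *%R X Y.

Definition strict_lower_mask (R : realType) (n : nat) : 'M[R]_n :=
  \matrix_(i < n, j < n) ((j < i)%N)%:R.

Definition orthogonal_group (R : realType) (n : nat) : set 'M[R]_n :=
  [set Q | Q^T *m Q = 1%:M].

Definition ball2 (R : realType) (n : nat) (M : R) : set 'cV[R]_n :=
  [set v | norm2 v <= M].

Definition ballF (R : realType) (n : nat) (M0 : R) : set 'M[R]_n :=
  [set X | normF X <= M0].

(* The coefficient matrices A_0, ..., A_n are indexed by 'I_n.+1, whereas the
   entries c_1, ..., c_n of c are numbered from 0: A_i for i >= 1 is
   A (lift ord0 (i - 1)). *)
Definition affine_mx (R : realType) (n : nat) (A : 'I_n.+1 -> 'M[R]_n)
    (c : 'cV[R]_n) : 'M[R]_n :=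
  A ord0 + \sum_(i < n) c i 0 *: A (lift ord0 i).

Notation triple R n := ('cV[R]_n * 'M[R]_n * 'M[R]_n)%type.

Definition Omega (R : realType) (n : nat) (M : R) : set (triple R n) :=
  [set p | [/\ ball2 M p.1.1, orthogonal_group p.1.2 & orthogonal_group p.2]].

Definition objective (R : realType) (n : nat) (A B : 'I_n.+1 -> 'M[R]_n)
    (lam : 'rV[R]_n) (p : triple R n) : R :=
  let c := p.1.1 in let Q := p.1.2 in let Z := p.2 in
  let QAZ := Q^T *m affine_mx A c *m Z in
  let QBZ := Q^T *m affine_mx B c *m Z in
  let P := strict_lower_mask R n in
  2^-1 * normF (hadamard (diag_mx lam) QBZ - hadamard 1%:M QAZ) ^+ 2
  + 2^-1 * normF (hadamard P QAZ) ^+ 2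
  + 2^-1 * normF (hadamard P QBZ) ^+ 2.

Definition dir_c (R : realType) (n : nat) (i : 'I_n) : triple R n :=
  (delta_mx i 0, 0, 0).
Definition dir_Q (R : realType) (n : nat) (i j : 'I_n) : triple R n :=
  (0, delta_mx i j, 0).
Definition dir_Z (R : realType) (n : nat) (i j : 'I_n) : triple R n :=
  (0, 0, delta_mx i j).

(* 'D_v F p is a total operator, with an unspecified value when the limit does
   not exist: [gradient F p] is meaningful when [has_gradient F p] holds. *)
Definition has_gradient (R : realType) (n : nat) (F : triple R n -> R)
    (p : triple R n) : Prop :=
  [/\ forall i, derivable F p (dir_c R i),
      forall i j, derivable F p (dir_Q R i j)
    & forall i j, derivable F p (dir_Z R i j)].

Definition gradient (R : realType) (n : nat) (F : triple R n -> R)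
    (p : triple R n) : triple R n :=
  (\col_i 'D_(dir_c R i) F p,
   \matrix_(i, j) 'D_(dir_Q R i j) F p,
   \matrix_(i, j) 'D_(dir_Z R i j) F p).

Definition normF3 (R : realType) (n : nat) (g : triple R n) : R :=
  Num.sqrt (\sum_i g.1.1 i 0 ^+ 2
            + \sum_i \sum_j g.1.2 i j ^+ 2
            + \sum_i \sum_j g.2 i j ^+ 2).

Definition gradient_lipschitz_on (R : realType) (n : nat) (D : set (triple R n))
    (F : triple R n -> R) : Prop :=
  (forall p, D p -> has_gradient F p) /\
  exists2 L : R, 0 < L &
    forall (c c' : 'cV[R]_n) (Q Q' Z Z' : 'M[R]_n),
      D (c, Q, Z) -> D (c', Q', Z') ->
      normF3 (gradient F (c, Q, Z) - gradient F (c', Q', Z'))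
        <= L * (normF (Q - Q') + normF (Z - Z') + norm2 (c - c')).

(* Main.v *)
Require Import Defs.
From mathcomp Require Import all_boot all_order all_algebra.
From mathcomp Require Import all_classical all_reals all_analysis.
Import Order.TTheory GRing.Theory Num.Theory.
Import numFieldNormedType.Exports.
Local Open Scope ring_scope.

Set Implicit Arguments.
Unset Strict Implicit.
Unset Printing Implicit Defensive.

(** The objective is a polynomial in the entries of c, Q and Z, and the domain
    is bounded: c lies in a ball, and every column of an orthogonal matrix is a
    unit vector, so the entries of Q and Z have absolute value at most 1. A
    polynomial has partial derivatives everywhere, these are again polynomials,
    and a polynomial is Lipschitz on a set where the coordinates are bounded.
    Summing the Lipschitz estimates over the finitely many partial derivatives
    gives the estimate for the gradient.

    Polynomials are handled as the algebra of functions generated by the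
    coordinate functions. [generated_objective] places the objective in this
    algebra, [generated_derive] shows that the algebra is stable under
    directional derivatives, and [generated_lipschitz] propagates boundedness
    and the Lipschitz property from the generators to the whole algebra. The
    Frobenius norms of matrices and of triples are compared with the sums of
    the absolute values of the entries, which reduces everything to scalar
    functions. *)

(** * The algebra generated by a set of functions *)

Inductive generated_algebra (R : realType) (T : Type) (S : set (T -> R)) :
    (T -> R) -> Prop :=
| GenCst a : generated_algebra S (cst a)
| GenIn l : S l -> generated_algebra S l
| GenD f g : generated_algebra S f -> generated_algebra S g ->
    generated_algebra S (fun x => f x + g x)
| GenM f g : generated_algebra S f -> generated_algebra S g ->
    generated_algebra S (fun x => f x * g x).

Section GeneratedAlgebra.
Variables (R : realType) (T : Type) (S : set (T -> R)).

Lemma generated_algebraB (f g : T -> R) :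
  generated_algebra S f -> generated_algebra S g ->
  generated_algebra S (fun x => f x - g x).
Proof.
move=> Sf Sg; have -> : (fun x => f x - g x) = fun x => f x + cst (-1) x * g x.
  by apply/funext => x /=; rewrite mulN1r.
by apply: GenD => //; apply: GenM => //; exact: GenCst.
Qed.

Lemma generated_algebra_sum (I : Type) (r : seq I) (f : I -> T -> R) :
  (forall i, generated_algebra S (f i)) ->
  generated_algebra S (fun x => \sum_(i <- r) f i x).
Proof.
move=> Sf; elim: r => [|i r IHr].
  by under eq_fun do rewrite big_nil; exact: GenCst.
by under eq_fun do rewrite big_cons; exact: GenD.
Qed.

(** A matrix-valued polynomial map, given entrywise: the objective is assembled
    from such maps by matrix operations. *)
Definition generated_mx (m n : nat) (X : T -> 'M[R]_(m, n)) : Prop :=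
  forall i j, generated_algebra S (fun x => X x i j).

Lemma generated_mx_cst m n (X : 'M[R]_(m, n)) : generated_mx (cst X).
Proof. by move=> i j; exact: GenCst. Qed.

Lemma generated_mxB m n (X Y : T -> 'M[R]_(m, n)) :
  generated_mx X -> generated_mx Y -> generated_mx (fun x => X x - Y x).
Proof.
by move=> SX SY i j; under eq_fun do rewrite !mxE; exact: generated_algebraB.
Qed.

Lemma generated_trmx m n (X : T -> 'M[R]_(m, n)) :
  generated_mx X -> generated_mx (fun x => (X x)^T).
Proof. by move=> SX i j; under eq_fun do rewrite mxE; exact: SX. Qed.

Lemma generated_mulmx m n p (X : T -> 'M[R]_(m, n)) (Y : T -> 'M[R]_(n, p)) :
  generated_mx X -> generated_mx Y -> generated_mx (fun x => X x *m Y x).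
Proof.
move=> SX SY i j; under eq_fun do rewrite mxE.
by apply: generated_algebra_sum => k; apply: GenM; [exact: SX|exact: SY].
Qed.

Lemma generated_hadamard m n (X Y : T -> 'M[R]_(m, n)) :
  generated_mx X -> generated_mx Y ->
  generated_mx (fun x => hadamard (X x) (Y x)).
Proof.
move=> SX SY i j; under eq_fun do rewrite mxE.
by apply: GenM; [exact: SX|exact: SY].
Qed.

Lemma generated_affine_mx n (A : 'I_n.+1 -> 'M[R]_n) (c : T -> 'cV[R]_n) :
  generated_mx c -> generated_mx (fun x => affine_mx A (c x)).
Proof.
move=> Sc i j; under eq_fun do rewrite mxE summxE.
apply: GenD; first exact: GenCst.
apply: generated_algebra_sum => k; under eq_fun do rewrite mxE.
by apply: GenM; [exact: Sc|exact: GenCst].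
Qed.

(** The norm itself is not polynomial, but its square is a sum of squares of
    entries; the objective contains only such squares. *)
Lemma generated_normF_sqr m n (X : T -> 'M[R]_(m, n)) :
  generated_mx X -> generated_algebra S (fun x => normF (X x) ^+ 2).
Proof.
move=> SX; under eq_fun => x.
  rewrite sqr_sqrtr; last by do 2![apply: sumr_ge0 => ? _]; exact: sqr_ge0.
  over.
apply: generated_algebra_sum => i; apply: generated_algebra_sum => j.
by under eq_fun do rewrite expr2; apply: GenM; exact: SX.
Qed.

(** Boundedness is carried along with the Lipschitz property because the
    Lipschitz constant of a product depends on bounds for both factors. *)
Definition bounded_lipschitz (D : set T) (d : T -> T -> R) (f : T -> R) : Prop :=
  (exists K, forall x, D x -> `|f x| <= K) /\
  exists2 L, 0 <= L & forall x y, D x -> D y -> `|f x - f y| <= L * d x y.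

(** For products this is the estimate
    |fg(x) - fg(y)| <= |f(x)| |g(x) - g(y)| + |g(y)| |f(x) - f(y)|. *)
Lemma generated_lipschitz (D : set T) (d : T -> T -> R) :
  (forall x y, 0 <= d x y) ->
  (forall l, S l -> bounded_lipschitz D d l) ->
  forall f, generated_algebra S f -> bounded_lipschitz D d f.
Proof.
move=> d_ge0 SP f; elim=> {f} [a|l /SP //|f g _ [[K fK] [L L0 fL]] _|
    f g _ [[K fK] [L L0 fL]] _].
- split; first by exists `|a|.
  by exists 0 => // x y _ _; rewrite subrr normr0 mul0r.
- move=> [[K' gK] [L' L'0 gL]]; split.
    by exists (K + K') => x Dx; rewrite (le_trans (ler_normD _ _))// lerD ?fK ?gK.
  exists (L + L') => [|x y Dx Dy]; first exact: addr_ge0.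
  by rewrite opprD addrACA mulrDl (le_trans (ler_normD _ _))// lerD ?fL ?gL.
- move=> [[K' gK] [L' L'0 gL]]; split.
    by exists (K * K') => x Dx; rewrite normrM ler_pM ?fK ?gK.
  (* The absolute values give nonnegative coefficients even when D is empty, in
     which case K and K' may be negative. *)
  exists (`|K| * L' + `|K'| * L) => [|x y Dx Dy].
    by rewrite addr_ge0 ?mulr_ge0.
  have -> : f x * g x - f y * g y = f x * (g x - g y) + g y * (f x - f y).
    by rewrite !mulrBr addrA [g y * f x]mulrC subrK [g y * f y]mulrC.
  rewrite (le_trans (ler_normD _ _))// !normrM mulrDl -!mulrA.
  apply: lerD; apply: ler_pM => //; rewrite ?fL ?gL //.
    exact: le_trans (fK _ Dx) (ler_norm _).
  exact: le_trans (gK _ Dy) (ler_norm _).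
Qed.

End GeneratedAlgebra.

(** Used with h i x y the absolute increment of a partial derivative: a finite
    family of Lipschitz constants adds up to a single one. *)
Lemma sum_le_distM (R : realType) (T : Type) (D : set T) (d : T -> T -> R)
    (I : Type) (r : seq I) (h : I -> T -> T -> R) :
  (forall i, exists2 L, 0 <= L &
     forall x y, D x -> D y -> h i x y <= L * d x y) ->
  exists2 L, 0 <= L &
    forall x y, D x -> D y -> \sum_(i <- r) h i x y <= L * d x y.
Proof.
move=> hL; elim: r => [|i r [L L0 rL]].
  by exists 0 => // x y _ _; rewrite big_nil mul0r.
have [K K0 iK] := hL i; exists (K + L) => [|x y Dx Dy]; first exact: addr_ge0.
by rewrite big_cons mulrDl lerD ?iK ?rL.
Qed.

(** * Directional derivatives *)

(** The difference quotient of a linear functional is constantly l v, so the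
    limit exists even for a discontinuous l. *)
Lemma is_derive_linear_functional (R : realType) (V : normedModType R)
    (l : V -> R) (x v : V) :
  (forall a u w, l (a *: u + w) = a * l u + l w) -> is_derive x v l (l v).
Proof.
move=> l_lin.
have cvgl : (h^-1 *: ((l \o shift x) (h *: v) - l x) @[h --> 0^'] --> l v)%classic.
  apply: cvg_near_cst; near=> h.
  rewrite /= l_lin addrK /GRing.scale /= mulKf//.
  near: h; exact: nbhs_dnbhs_neq.
by split; [apply/cvg_ex; exists (l v)|exact: cvg_lim].
Unshelve. all: by end_near. Qed.

(** By the Leibniz rule it suffices to differentiate the generators, and the
    derivative of a linear functional along v is constant. *)
Lemma generated_derive (R : realType) (V : normedModType R) (S : set (V -> R))
    (S_lin : forall l, S l -> forall a u w, l (a *: u + w) = a * l u + l w)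
    (v : V) (f : V -> R) :
  generated_algebra S f ->
  (forall x, derivable f x v) /\ generated_algebra S (fun x => 'D_v f x).
Proof.
move=> Sf.
suff [df Sdf fdf] : exists2 df, generated_algebra S df &
    forall x, is_derive x v f (df x).
  split=> [x|]; first exact: ex_derive.
  by under eq_fun do rewrite derive_val.
elim: Sf => {f} [a|l Sl|f g Sf [df Sdf fdf] Sg [dg Sdg gdg]|
    f g Sf [df Sdf fdf] Sg [dg Sdg gdg]].
- by exists (cst 0) => [|x]; [exact: GenCst|exact: is_derive_cst].
- exists (cst (l v)) => [|x]; first exact: GenCst.
  by apply: is_derive_linear_functional; exact: S_lin.
- by exists (fun x => df x + dg x) => [|x]; [exact: GenD|exact: is_deriveD].
- exists (fun x => f x * dg x + g x * df x) => [|x]; last exact: is_deriveM.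
  by apply: GenD; exact: GenM.
Qed.

(** * Euclidean norms and entries *)

Lemma sqrtrD_le (R : rcfType) (a b : R) :
  0 <= a -> 0 <= b -> Num.sqrt (a + b) <= Num.sqrt a + Num.sqrt b.
Proof.
move=> a0 b0; rewrite -(ler_pXn2r (ltn0Sn 1)) ?nnegrE ?addr_ge0 ?sqrtr_ge0//.
rewrite sqrrD !sqr_sqrtr ?addr_ge0// lerD2r lerDl.
by rewrite mulrn_wge0 ?mulr_ge0 ?sqrtr_ge0.
Qed.

Lemma sqrtr_sum_le (R : rcfType) (I : Type) (r : seq I) (a : I -> R) :
  (forall i, 0 <= a i) ->
  Num.sqrt (\sum_(i <- r) a i) <= \sum_(i <- r) Num.sqrt (a i).
Proof.
move=> a0; elim: r => [|i r IHr]; first by rewrite !big_nil sqrtr0.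
rewrite !big_cons (le_trans (sqrtrD_le _ _))//; first exact: sumr_ge0.
by rewrite lerD2l.
Qed.

Lemma normF_le (R : realType) m n (X : 'M[R]_(m, n)) :
  normF X <= \sum_i \sum_j `|X i j|.
Proof.
have sq0 i j : 0 <= X i j ^+ 2 by exact: sqr_ge0.
apply: le_trans (sqrtr_sum_le _ _) _ => [i|]; first exact: sumr_ge0.
apply: ler_sum => i _; apply: le_trans (sqrtr_sum_le _ _) _ => [j|]; first by [].
by apply: ler_sum => j _; rewrite sqrtr_sqr.
Qed.

Lemma normr_entry_le_normF (R : realType) m n (X : 'M[R]_(m, n)) i j :
  `|X i j| <= normF X.
Proof.
rewrite -sqrtr_sqr ler_wsqrtr// (bigD1 i)//= (bigD1 j)//= -addrA lerDl.
rewrite addr_ge0//; do ![apply: sumr_ge0 => ? _]; exact: sqr_ge0.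
Qed.

Lemma norm2E (R : realType) n (v : 'cV[R]_n) : norm2 v = normF v.
Proof. by congr Num.sqrt; apply: eq_bigr => i _; rewrite big_ord1. Qed.

Lemma normF3_le (R : realType) n (g : triple R n) :
  normF3 g <= \sum_i \sum_j `|g.1.1 i j| + \sum_i \sum_j `|g.1.2 i j|
              + \sum_i \sum_j `|g.2 i j|.
Proof.
have sq0 (m p : nat) (X : 'M[R]_(m, p)) : 0 <= \sum_i \sum_j X i j ^+ 2.
  by do 2![apply: sumr_ge0 => ? _]; exact: sqr_ge0.
have c0 : 0 <= \sum_i g.1.1 i 0 ^+ 2 by apply: sumr_ge0 => i _; exact: sqr_ge0.
rewrite (le_trans (sqrtrD_le _ _)) ?addr_ge0// lerD ?normF_le//.
rewrite (le_trans (sqrtrD_le _ _))// lerD ?normF_le//.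
by rewrite -/(norm2 g.1.1) norm2E normF_le.
Qed.

(** The columns of an orthogonal matrix are unit vectors. *)
Lemma orthogonal_group_entry_le1 (R : realType) n (Q : 'M[R]_n) i j :
  orthogonal_group Q -> `|Q i j| <= 1.
Proof.
move=> /matrixP /(_ j j); rewrite !mxE eqxx /= => QQ.
rewrite -sqrtr_sqr -sqrtr1 ler_wsqrtr//; move: QQ; rewrite mulr1n => <-.
rewrite (bigD1 i)//= mxE -expr2 lerDl.
by apply: sumr_ge0 => k _; rewrite mxE -expr2 sqr_ge0.
Qed.

(** * The objective as a polynomial in the entries *)

Definition triple_dist (R : realType) n (p q : triple R n) : R :=
  normF (p.1.2 - q.1.2) + normF (p.2 - q.2) + norm2 (p.1.1 - q.1.1).

Lemma normF_ge0 (R : realType) m n (X : 'M[R]_(m, n)) : 0 <= normF X.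
Proof. exact: sqrtr_ge0. Qed.

Lemma triple_dist_ge0 (R : realType) n (p q : triple R n) :
  0 <= triple_dist p q.
Proof. by rewrite /triple_dist norm2E !addr_ge0 ?normF_ge0. Qed.

Inductive coordinate (R : realType) (n : nat) : set (triple R n -> R) :=
| CoordC i j : coordinate (fun p => p.1.1 i j)
| CoordQ i j : coordinate (fun p => p.1.2 i j)
| CoordZ i j : coordinate (fun p => p.2 i j).

Lemma coordinate_linear (R : realType) n (l : triple R n -> R) :
  coordinate l -> forall a u w, l (a *: u + w) = a * l u + l w.
Proof. by case=> i j a u w; rewrite /= !mxE. Qed.

Lemma coordinate_lipschitz (R : realType) n (M : R) (l : triple R n -> R) :
  coordinate l -> bounded_lipschitz (Omega M) (@triple_dist R n) l.
Proof.
rewrite /triple_dist => -[] i j; split;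
  try (exists 1 => // p q _ _; rewrite mul1r norm2E).
- exists M => p [cM _ _]; apply: le_trans cM.
  by rewrite norm2E; exact: normr_entry_le_normF.
- have := normr_entry_le_normF (p.1.1 - q.1.1) i j.
  rewrite !mxE => /le_trans -> //.
  by rewrite lerDr addr_ge0 ?normF_ge0.
- by exists 1 => p [_ oQ _]; exact: orthogonal_group_entry_le1.
- have := normr_entry_le_normF (p.1.2 - q.1.2) i j.
  rewrite !mxE => /le_trans -> //.
  by rewrite -addrA lerDl addr_ge0 ?normF_ge0.
- by exists 1 => p [_ _ oZ]; exact: orthogonal_group_entry_le1.
- have := normr_entry_le_normF (p.2 - q.2) i j.
  rewrite !mxE => /le_trans -> //.
  by rewrite addrAC lerDr addr_ge0 ?normF_ge0.
Qed.

Lemma generated_objective (R : realType) n (A B : 'I_n.+1 -> 'M[R]_n)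
    (lam : 'rV[R]_n) :
  generated_algebra (@coordinate R n) (objective A B lam).
Proof.
pose G := @generated_mx R _ (@coordinate R n).
have Gc : G _ _ (fun p => p.1.1) by move=> i j; apply: GenIn; constructor.
have GQ : G _ _ (fun p => p.1.2) by move=> i j; apply: GenIn; constructor.
have GZ : G _ _ (fun p => p.2) by move=> i j; apply: GenIn; constructor.
have GX (X : 'I_n.+1 -> 'M[R]_n) :
    G _ _ (fun p => p.1.2^T *m affine_mx X p.1.1 *m p.2).
  apply: generated_mulmx => //; apply: generated_mulmx.
    exact: generated_trmx.
  exact: generated_affine_mx.
have Gmask (X : 'M[R]_n) (Y : triple R n -> 'M[R]_n) :
    G _ _ Y -> G _ _ (fun p => hadamard X (Y p)).
  by apply: generated_hadamard; exact: generated_mx_cst.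
have Gsqr (X : triple R n -> 'M[R]_n) : G _ _ X ->
    generated_algebra (@coordinate R n) (fun p => 2^-1 * normF (X p) ^+ 2).
  by move=> GX'; apply: GenM; [exact: GenCst|exact: generated_normF_sqr].
apply: GenD; first apply: GenD; apply: Gsqr; last 2 first.
- exact: Gmask.
- exact: Gmask.
- by apply: generated_mxB; exact: Gmask.
Qed.

Theorem theorem4 (R : realType) (n : nat)
  (A B : 'I_n.+1 -> 'M[R]_n) (lam : 'rV[R]_n)
  (lam_sorted : forall i j : 'I_n, (i <= j)%N -> lam 0 i <= lam 0 j)
  (M M0 : R) (M_ge0 : 0 <= M) (M0_ge0 : 0 <= M0)
  (A_R0 : forall i : 'I_n.+1, ballF M0 (A i))
  (B_R0 : forall i : 'I_n.+1, ballF M0 (B i))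
  (Lam_R0 : ballF M0 (diag_mx lam))
  (Ac_R0 : forall c : 'cV[R]_n, ball2 M c -> ballF M0 (affine_mx A c))
  (Bc_R0 : forall c : 'cV[R]_n, ball2 M c -> ballF M0 (affine_mx B c)) :
  gradient_lipschitz_on (Omega M) (objective A B lam).
Proof.
have GF := generated_objective A B lam.
have Gder v := generated_derive (@coordinate_linear R n) v GF.
split=> [p _|]; first by split=> *; apply: (Gder _).1.
have lipD v := generated_lipschitz (@triple_dist_ge0 R n)
  (@coordinate_lipschitz R n M) (Gder v).2.
have lip_entries m k (v : 'I_m -> 'I_k -> triple R n) :
    exists2 L, 0 <= L & forall p q, Omega M p -> Omega M q ->
    \sum_i \sum_j `|'D_(v i j) (objective A B lam) p -
                    'D_(v i j) (objective A B lam) q| <= L * triple_dist p q.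
  apply: sum_le_distM => i; apply: sum_le_distM => j.
  exact: (lipD _).2.
(* The partial derivatives in c are summed as those of a one-column matrix. *)
have [Lc Lc0 lipc] := lip_entries n 1 (fun i _ => dir_c R i).
have [LQ LQ0 lipQ] := lip_entries n n (fun i j => dir_Q R i j).
have [LZ LZ0 lipZ] := lip_entries n n (fun i j => dir_Z R i j).
(* The constants found are only nonnegative; adding 1 makes L positive. *)
exists (Lc + LQ + LZ + 1) => [|c c' Q Q' Z Z' Dp Dq].
  by rewrite ltr_wpDl ?addr_ge0.
apply: (@le_trans _ _ ((Lc + LQ + LZ) * triple_dist (c, Q, Z) (c', Q', Z'))).
  rewrite (le_trans (normF3_le _))// !mulrDl /=.
  do !apply: lerD.
  - by under eq_bigr do under eq_bigr do rewrite !mxE; exact: lipc.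
  - by under eq_bigr do under eq_bigr do rewrite !mxE; exact: lipQ.
  - by under eq_bigr do under eq_bigr do rewrite !mxE; exact: lipZ.
by rewrite ler_wpM2r ?triple_dist_ge0 // lerDl.
Qed.
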